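(* Let $N\in\mathbb{N}$ and let $\mathcal{T}\colon\mathcal{X}\to\mathcal{Y}$ be given by the finite singular-value decomposition $$\mathcal{T}F=\sum_{n=1}^N\sigma_n\langle F,u_n\rangle_{\mathcal{X}}\,v_n,\quad F\in\mathcal{X},$$ with $\sigma_n\in\mathbb{C}\setminus\{0\}$, $(u_n)_{n=1,\dots,N}$ orthonormal in $\mathcal{X}$ and $(v_n)_{n=1,\dots,N}$ orthonormal in $\mathcal{Y}$. Let $A\in\mathbb{C}^{N\times N}$ be the matrix $$A=\left(\overline{\sigma_m}\,\langle \mathcal{P}v_n,\mathcal{P}v_m\rangle_{\mathcal{Z}}\,\sigma_n\right)_{m,n=1,\dots,N}$$ ($m$ the row index, $n$ the column index). Then $A$ is self-adjoint with real non-negative eigenvalues. Let $f^{(1)},\dots,f^{(N)}\in\mathbb{C}^N$ be any orthonormal basis of eigenvectors of $A$, with associated eigenvalues sorted so that $\varrho_1\geq\varrho_2\geq\dots\geq\varrho_N\geq 0$, and set $$g_k:=\sum_{n=1}^N f^{(k)}_n u_n\in\mathcal{X},\quad k=1,\dots,N.$$ Let $\tilde N:=\max\{k\mid\varrho_k\neq 0\}$ (with $\tilde N:=0$ if all $\varrho_k$ vanish), and for $k=1,\dots,\tilde N$ set $\tau_k:=\varrho_k^{1/2}$ and $h_k:=\varrho_k^{-1/2}\,\mathcal{P}\mathcal{T}g_k\in\mathcal{Z}$. Then: 1. $\langle g_k,g_l\rangle_{\mathcal{X}}=\delta_{kl}$ and $\langle\mathcal{P}\mathcal{T}g_k,\mathcal{P}\mathcal{T}g_l\rangle_{\mathcal{Z}}=\varrho_k\delta_{kl}$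 for all $k,l=1,\dots,N$; 2. $(g_k)_{k=1,\dots,\tilde N}$ is an orthonormal basis of $(\ker\mathcal{P}\mathcal{T})^{\perp}$, the orthogonal complement in $\mathcal{X}$ of the null space of $\mathcal{P}\mathcal{T}$; 3. $(h_k)_{k=1,\dots,\tilde N}$ is an orthonormal system in $\mathcal{Z}$, and $(\iota(h_k))_{k=1,\dots,\tilde N}$ is an orthonormal system in $\mathcal{Y}$; 4. $\mathcal{P}\mathcal{T}$ has the singular-value decomposition $$\mathcal{P}\mathcal{T}F=\sum_{k=1}^{\tilde N}\tau_k\,\langle F,g_k\rangle_{\mathcal{X}}\,h_k\quad\text{for all }F\in\mathcal{X}.$$
   Context: $\mathcal{X},\mathcal{Y},\mathcal{Z}$ are non-trivial (complex) Hilbert spaces with inner products $\langle\cdot,\cdot\rangle_{\mathcal{X}},\langle\cdot,\cdot\rangle_{\mathcal{Y}},\langle\cdot,\cdot\rangle_{\mathcal{Z}}$, linear in the first argument and conjugate-linear in the second. $\iota\colon\mathcal{Z}\hookrightarrow\mathcal{Y}$ is a linear isometric embedding, i.e. $\langle\iota(F_1),\iota(F_2)\rangle_{\mathcal{Y}}=\langle F_1,F_2\rangle_{\mathcal{Z}}$ for all $F_1,F_2\in\mathcal{Z}$. $\mathcal{P}\colon\mathcal{Y}\to\mathcal{Z}$ is a continuous linear projection in the sense that, identifying $\mathcal{Z}$ with $\iota(\mathcal{Z})\subset\mathcal{Y}$, $\mathcal{P}(\mathcal{P}G)=\mathcal{P}G$ for all $G\in\mathcal{Y}$ (that is, $\mathcal{P}(\iota(\mathcal{P}G))=\mathcal{P}G$),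 and $\mathcal{P}\circ\iota=\mathrm{Id}_{\mathcal{Z}}$. (Typical example: $\mathcal{Y}=L^2(\tilde D)$, $\mathcal{Z}=L^2(R)$ with $R\subset\tilde D$, $\mathcal{P}$ the restriction to $R$, $\iota$ extension by zero.) The $g_k$ are called Slepian functions. *)

(* Defs.v *)
From HB Require Import structures.
From mathcomp Require Import all_boot all_order all_algebra.
From mathcomp Require Import complex.
From mathcomp Require Import all_classical all_reals.
From mathcomp Require Import topology normedtype.

Set Implicit Arguments.
Unset Strict Implicit.
Unset Printing Implicit Defensive.

Import Order.TTheory GRing.Theory Num.Theory.
Import numFieldNormedType.Exports.
Local Open Scope classical_set_scope.
Local Open Scope ring_scope.

(* A complex Hilbert space: a complete normed module over R[i] whose norm is
   induced by a positive definite Hermitian form, linear in its first argument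
   and conjugate-linear in the second. *)
HB.mixin Record isHilbert (R : realType) (H : Type)
    of CompleteNormedModule R[i] H := {
  inner : {dot H for (@Num.conj R[i])} ;
  inner_norm : forall x : H, inner x x = `|x| ^+ 2
}.

#[short(type="hilbertType")]
HB.structure Definition Hilbert (R : realType) :=
  {H of CompleteNormedModule R[i] H & isHilbert R H}.

Arguments inner {R s}.

Notation "''[' x , y ]" := (inner x y) : ring_scope.

(* The inner product is an argument, so that the next definitions also apply to
   column vectors, which carry no hilbertType structure. *)
Definition orthonormal_family (C : numClosedFieldType) (V : lmodType C)
    (dot : V -> V -> C) (n : nat) (e : 'I_n -> V) : Prop :=
  forall i j, dot (e i) (e j) = (i == j)%:R.

(* A finite family has a closed linear span, so totality of e in S is the
   existence of finite expansions. *)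
Definition orthonormal_basis (C : numClosedFieldType) (V : lmodType C)
    (dot : V -> V -> C) (S : set V) (n : nat) (e : 'I_n -> V) : Prop :=
  [/\ orthonormal_family dot e,
      forall i, S (e i) &
      forall x, S x -> exists c : 'I_n -> C, x = \sum_i c i *: e i].

Definition orthogonal_complement (R : realType) (H : hilbertType R)
    (S : set H) : set H := [set x | forall y, S y -> '[x, y] = 0].

Definition dotcv (C : numClosedFieldType) (n : nat) (a b : 'cV[C]_n) : C :=
  dotmx a^T b^T.

(* Column eigenvectors; the library's eigenvalue and eigenspace are about row
   vectors. *)
Definition eigenpair (C : numClosedFieldType) (n : nat) (A : 'M[C]_n) (a : C)
    (f : 'cV[C]_n) : Prop := f != 0 /\ A *m f = a *: f.

(* Singular values are arbitrary nonzero complex numbers here. *)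
Definition finite_svd (R : realType) (H K : hilbertType R) (L : H -> K)
    (n : nat) (s : 'I_n -> R[i]) (u : 'I_n -> H) (v : 'I_n -> K) : Prop :=
  [/\ forall i, s i != 0,
      orthonormal_family inner u,
      orthonormal_family inner v &
      forall F, L F = \sum_i (s i * '[F, u i]) *: v i].

(* max {k | rho_k != 0} for 1-based k: the ordinal k stands for k.+1, and the
   empty maximum is 0. *)
Definition Ntilde (C : numClosedFieldType) (N : nat) (rho : 'I_N -> C) : nat :=
  \max_(k < N | rho k != 0) k.+1.

Lemma Ntilde_le (C : numClosedFieldType) (N : nat) (rho : 'I_N -> C) :
  (Ntilde rho <= N)%N.
Proof. by apply/bigmax_leqP => k _; exact: ltn_ord. Qed.

Definition widen_Ntilde (C : numClosedFieldType) (N : nat) (rho : 'I_N -> C) :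
  'I_(Ntilde rho) -> 'I_N := widen_ord (Ntilde_le rho).

(* Main.v *)
From HB Require Import structures.
Require Import Defs.
From mathcomp Require Import all_boot all_order all_algebra.
From mathcomp Require Import complex.
From mathcomp Require Import all_classical all_reals.
From mathcomp Require Import topology normedtype.

(** [A] is the Gram matrix of the vectors [w_n = sigma_n P v_n], and
    [PT F = \sum_n <F, u_n> w_n]. Hence [<PT (\sum a_n u_n), PT (\sum b_n u_n)>]
    is [<A a, b>], which gives non-negativity of the spectrum and, on an
    eigenbasis, [<PT g_k, PT g_l> = rho_k delta_kl]. The [g_k] have the same span
    as the [u_n], so [PT F = \sum_k <F, g_k> PT g_k], where the terms with
    [rho_k = 0] vanish. If [x] is orthogonal to the kernel, then
    [y = x - \sum_k <x, g_k> g_k] (over the [k] with [rho_k != 0]) lies in the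
    kernel and is orthogonal to [x] and to these [g_k], so [<y, y> = 0]. *)

Set Implicit Arguments.
Unset Strict Implicit.
Unset Printing Implicit Defensive.

Import Order.TTheory GRing.Theory Num.Theory.
Import numFieldNormedType.Exports.
Local Open Scope classical_set_scope.
Local Open Scope ring_scope.

Section Inner.
Variables (R : realType) (H : hilbertType R).
Implicit Types (x y z : H) (a : R[i]).

Lemma innerC x y : '[x, y] = ('[y, x])^*.
Proof. by rewrite hermC mul1r. Qed.

Lemma innerZl a x y : '[a *: x, y] = a * '[x, y].
Proof. exact: linearZl_LR. Qed.

Lemma innerZr a x y : '[x, a *: y] = a^* * '[x, y].
Proof. exact: linearZr_LR. Qed.

Lemma innerBl x y z : '[x - y, z] = '[x, z] - '[y, z].
Proof. exact: linearBl. Qed.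

Lemma inner_suml (I : finType) (F : I -> H) y :
  '[\sum_i F i, y] = \sum_i '[F i, y].
Proof. exact: linear_sumlz. Qed.

Lemma inner_sumr (I : finType) (F : I -> H) x :
  '[x, \sum_i F i] = \sum_i '[x, F i].
Proof. exact: linear_sumr. Qed.

End Inner.

Lemma dotcvE (C : numClosedFieldType) n (a b : 'cV[C]_n) :
  dotcv a b = \sum_i a i 0 * (b i 0)^*.
Proof. by rewrite /dotcv dotmxE mxE; apply: eq_bigr => i _; rewrite !mxE. Qed.

Lemma dotcv_suml (C : numClosedFieldType) n (I : finType)
    (c : I -> C) (f : I -> 'cV[C]_n) b :
  dotcv (\sum_i c i *: f i) b = \sum_i c i * dotcv (f i) b.
Proof.
rewrite dotcvE; under eq_bigr do rewrite summxE mulr_suml.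
rewrite exchange_big; apply: eq_bigr => i _.
by rewrite dotcvE mulr_sumr; apply: eq_bigr => j _; rewrite mxE mulrA.
Qed.

Lemma dotcvZl (C : numClosedFieldType) n c (a b : 'cV[C]_n) :
  dotcv (c *: a) b = c * dotcv a b.
Proof.
by rewrite !dotcvE mulr_sumr; apply: eq_bigr => i _; rewrite mxE mulrA.
Qed.

Lemma dotcv_gt0 (C : numClosedFieldType) n (a : 'cV[C]_n) :
  a != 0 -> 0 < dotcv a a.
Proof. by move=> a0; rewrite /dotcv dnorm_gt0 trmx_eq0. Qed.

(** Pairing the expansion supplied by totality with [f k] isolates its [k]-th coefficient. *)
Lemma dotcv_basis_expand (C : numClosedFieldType) n (f : 'I_n -> 'cV[C]_n) a :
  orthonormal_basis (@dotcv C n) setT f -> a = \sum_k dotcv a (f k) *: f k.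
Proof.
case=> fo _ /(_ a Logic.I)[c ->]; apply: eq_bigr => k _; congr (_ *: _).
rewrite dotcv_suml (bigD1 k)//= fo eqxx mulr1 big1 ?addr0// => l lk.
by rewrite fo (negbTE lk) mulr0.
Qed.

Definition lincomb (C : numClosedFieldType) (V : lmodType C) n
  (w : 'I_n -> V) (a : 'cV[C]_n) : V := \sum_i a i 0 *: w i.

(** The index order makes the matrix act from the left on coefficient columns, the form being linear
    in its first argument. *)
Definition gram (R : realType) (H : hilbertType R) n (w : 'I_n -> H) :
  'M[R[i]]_n := \matrix_(i, j) '[w j, w i].

Section Gram.
Variables (R : realType) (H : hilbertType R) (n : nat) (w : 'I_n -> H).
Implicit Types a b : 'cV[R[i]]_n.

Lemma inner_lincomb a b :
  '[lincomb w a, lincomb w b] = dotcv (gram w *m a) b.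
Proof.
rewrite inner_sumr dotcvE; apply: eq_bigr => i _.
rewrite innerZr inner_suml mulrC mxE; congr (_ * _).
by apply: eq_bigr => j _; rewrite innerZl mxE mulrC.
Qed.

Lemma gram_hermsymmx : gram w \is hermsymmx.
Proof.
by apply/is_hermitianmxP/matrixP => i j; rewrite expr0 scale1r !mxE innerC.
Qed.

Lemma gram_orthonormal : orthonormal_family inner w -> gram w = 1%:M.
Proof. by move=> wo; apply/matrixP => i j; rewrite !mxE wo eq_sym. Qed.

(** The squared norm of [lincomb w a] equals [c * dotcv a a], whose second factor is positive. *)
Lemma gram_eigenpair_ge0 c a : eigenpair (gram w) c a -> 0 <= c.
Proof.
case=> a0 ea; have := dnorm_ge0 inner (lincomb w a).
by rewrite inner_lincomb ea dotcvZl pmulr_lge0 ?dotcv_gt0.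
Qed.

End Gram.

Lemma Ntilde_gt (C : numClosedFieldType) N (rho : 'I_N -> C) (k : 'I_N) :
  rho k != 0 -> (k < Ntilde rho)%N.
Proof. by move=> k0; rewrite /Ntilde (bigD1 k)//= leq_max leqnn. Qed.

(** A zero at [k] would force, by sortedness and non-negativity, zeros at all later indices. Every
    nonzero value would then sit strictly before [k], so the maximum of the shifted indices would be
    at most [k]. *)
Lemma widen_Ntilde_neq0 (C : numClosedFieldType) N (rho : 'I_N -> C) :
  (forall k, 0 <= rho k) ->
  (forall k l : 'I_N, (k <= l)%N -> rho l <= rho k) ->
  forall k : 'I_(Ntilde rho), rho (widen_Ntilde k) != 0.
Proof.
move=> rho0 mono k; apply/negP => /eqP k0.
have: (Ntilde rho <= k)%N.
  apply/bigmax_leqP => l l0; rewrite ltnNge; apply/negP => kl.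
  have := mono (widen_Ntilde k) l kl; rewrite k0 => l0'.
  by move: l0; rewrite eq_le l0' rho0.
by rewrite leqNgt ltn_ord.
Qed.

(** By maximality [rho] vanishes at each index from [Ntilde rho] on, so the tail of the sum is
    zero. *)
Lemma big_widen_Ntilde (C : numClosedFieldType) N (rho : 'I_N -> C)
    (V : zmodType) (F : 'I_N -> V) :
  (forall k, rho k = 0 -> F k = 0) ->
  \sum_k F k = \sum_(k < Ntilde rho) F (widen_Ntilde k).
Proof.
move=> F0; rewrite [LHS](bigID (fun k : 'I_N => (k < Ntilde rho)%N)) /=.
rewrite [X in _ + X]big1 ?addr0 => [|k kN]; first exact: big_ord_narrow.
by apply: F0; apply/eqP; apply: contraNT kN; exact: Ntilde_gt.
Qed.

(** * Singular system of an operator with orthogonal images [L (g k)] *)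

Section SingularSystem.
Variables (R : realType) (X Z : hilbertType R) (N : nat).
Variables (L : {linear X -> Z}) (g : 'I_N -> X) (rho : 'I_N -> R[i]).
Hypothesis g_orthonormal : orthonormal_family inner g.
Hypothesis L_g : forall k l, '[L (g k), L (g l)] = rho k * (k == l)%:R.
Hypothesis L_expand : forall F, L F = \sum_k '[F, g k] *: L (g k).
Hypothesis rho_ge0 : forall k, 0 <= rho k.
Hypothesis rho_mono : forall k l : 'I_N, (k <= l)%N -> rho l <= rho k.

Let g' (k : 'I_(Ntilde rho)) := g (widen_Ntilde k).
Let tau (k : 'I_(Ntilde rho)) := sqrtC (rho (widen_Ntilde k)).
Let h k := (tau k)^-1 *: L (g' k).

Let widen_inj : injective (@widen_Ntilde _ _ rho).
Proof. by move=> k l /(congr1 val) kl; exact: val_inj. Qed.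

Let tau_neq0 k : tau k != 0.
Proof. by rewrite sqrtC_eq0 widen_Ntilde_neq0. Qed.

Let L_expand_trunc F : L F = \sum_k '[F, g' k] *: L (g' k).
Proof.
rewrite L_expand (big_widen_Ntilde (rho := rho))// => k k0.
suff -> : L (g k) = 0 by rewrite scaler0.
by apply/eqP; rewrite -(dnorm_eq0 inner) L_g k0 mul0r.
Qed.

Let g'_orthonormal : orthonormal_family inner g'.
Proof. by move=> k l; rewrite g_orthonormal (inj_eq widen_inj). Qed.

(** For [F] in the kernel, expanding [L F = 0] and pairing with [L (g' k)] leaves ['[F, g' k]] times
    a nonzero [rho]. *)
Let g'_perp k : orthogonal_complement (L @^-1` [set 0]) (g' k).
Proof.
move=> F /= LF; have : '[L F, L (g' k)] = 0 by rewrite LF linear0l.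
rewrite L_expand inner_suml (bigD1 (widen_Ntilde k))//= big1 => [|l lk].
  rewrite addr0 innerZl L_g eqxx mulr1 => /eqP.
  rewrite mulf_eq0 (negbTE (widen_Ntilde_neq0 _ _ _)) ?orbF// => /eqP Fg.
  by rewrite innerC Fg conjC0.
by rewrite innerZl L_g (negbTE lk) !mulr0.
Qed.

Lemma singular_basis :
  orthonormal_basis inner (orthogonal_complement (L @^-1` [set 0])) g'.
Proof.
split=> // x xperp; exists (fun k => '[x, g' k]).
apply/eqP; rewrite -subr_eq0 -(dnorm_eq0 inner); apply/eqP.
set y := x - _.
have Ly : L y = 0.
  rewrite linearB linear_sum /= {1}L_expand_trunc; apply/eqP; rewrite subr_eq0.
  by apply/eqP; apply: eq_bigr => k _; rewrite linearZ.
(* Only the left copy of [y] is unfolded: the right one stays a kernel element, orthogonal to [x]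
   and to every [g' k]. *)
rewrite {1}/y innerBl xperp// inner_suml big1 ?subr0// => k _.
by rewrite innerZl g'_perp ?mulr0.
Qed.

Lemma singular_image_orthonormal : orthonormal_family inner h.
Proof.
move=> k l; rewrite innerZl innerZr L_g (inj_eq widen_inj).
case: eqP => [->|_]; last by rewrite !mulr0.
(* Since [tau l] is real, conjugation drops out and the product is [tau^-1 * tau^-1 * tau^2]. *)
have tVr : (tau l)^-1 \is Num.real by rewrite ger0_real ?invr_ge0 ?sqrtC_ge0.
rewrite mulr1 (conj_Creal tVr) -[rho _]sqrtCK -/(tau l) expr2.
by rewrite mulKf// mulVf.
Qed.

Lemma singular_svd : finite_svd L tau g' h.
Proof.
split=> //; first exact: singular_image_orthonormal.
move=> F; rewrite L_expand_trunc; apply: eq_bigr => k _.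
by rewrite /h scalerA mulrAC mulfV ?mul1r.
Qed.

End SingularSystem.

Theorem mainTheorem1 (R : realType) (X Y Z : hilbertType R)
    (hX : exists x : X, x != 0)
    (hY : exists y : Y, y != 0)
    (hZ : exists z : Z, z != 0)
    (iota : {linear Z -> Y})
    (iota_isometry : forall F1 F2 : Z, '[iota F1, iota F2] = '[F1, F2])
    (P : {linear Y -> Z})
    (P_continuous : continuous P)
    (P_projection : forall G : Y, P (iota (P G)) = P G)
    (P_iota : forall F : Z, P (iota F) = F)
    (N : nat) (T : X -> Y)
    (sigma : 'I_N -> R[i]) (u : 'I_N -> X) (v : 'I_N -> Y)
    (T_svd : finite_svd T sigma u v) :
  let A : 'M[R[i]]_N :=
    \matrix_(m, n) (Num.conj (sigma m) * '[P (v n), P (v m)] * sigma n) in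
  let PT : X -> Z := fun F => P (T F) in
  [/\ A \is hermsymmx,
      forall (a : R[i]) (f : 'cV[R[i]]_N),
        eigenpair A a f -> a \is Num.real /\ 0 <= a &
  forall (f : 'I_N -> 'cV[R[i]]_N) (rho : 'I_N -> R[i]),
    orthonormal_basis (@dotcv R[i] N) setT f ->
    (forall k, eigenpair A (rho k) (f k)) ->
    (forall k l : 'I_N, (k <= l)%N -> rho l <= rho k) ->
    let g : 'I_N -> X := fun k => \sum_n f k n 0 *: u n in
    let g' : 'I_(Ntilde rho) -> X := fun k => g (widen_Ntilde k) in
    let tau : 'I_(Ntilde rho) -> R[i] :=
      fun k => sqrtC (rho (widen_Ntilde k)) in
    let h : 'I_(Ntilde rho) -> Z := fun k => (tau k)^-1 *: PT (g' k) in
    [/\ forall k, 0 <= rho k,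
        (forall k l, '[g k, g l] = (k == l)%:R) /\
        (forall k l, '[PT (g k), PT (g l)] = rho k * (k == l)%:R),
        orthonormal_basis inner (orthogonal_complement (PT @^-1` [set 0])) g',
        orthonormal_family inner h /\
        orthonormal_family inner (fun k => iota (h k)) &
        finite_svd PT tau g' h]].
Proof.
case: T_svd => _ uo _ TE A PT.
pose w n := sigma n *: P (v n).
pose coef F : 'cV[R[i]]_N := \col_n '[F, u n].
have AE : A = gram w.
  by apply/matrixP => m n; rewrite !mxE innerZl innerZr [RHS]mulrC.
(* [PT] depends on [F] only through its coordinates along [u]. *)
have PTE F : PT F = lincomb w (coef F).
  rewrite /PT TE linear_sum; apply: eq_bigr => n _ /=.
  by rewrite linearZ /= mxE scalerA mulrC.
have coefZD : linear coef.
  by move=> a x y; apply/matrixP => i j; rewrite !mxE linearPl.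
have coef_lin a : coef (lincomb u a) = a.
  apply/colP => n; rewrite mxE inner_suml (bigD1 n)//= innerZl uo eqxx mulr1.
  by rewrite big1 ?addr0// => m mn; rewrite innerZl uo (negbTE mn) mulr0.
(* [T] is a bare function, so linearity is read off its singular-value formula. *)
have PT_lin : linear PT.
  move=> a x y; rewrite !PTE coefZD /lincomb scaler_sumr -big_split /=.
  by apply: eq_bigr => n _; rewrite !mxE scalerDl -scalerA.
split; first by rewrite AE gram_hermsymmx.
  move=> a f; rewrite AE => /gram_eigenpair_ge0 a0; split=> //.
  exact: ger0_real.
move=> f rho fb fe mono g.
have rho0 k : 0 <= rho k by move: (fe k); rewrite AE => /gram_eigenpair_ge0.
have [fo _ _] := fb.
have go : orthonormal_family inner g.
  by move=> k l; rewrite inner_lincomb gram_orthonormal// mul1mx fo.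
have PTg k l : '[PT (g k), PT (g l)] = rho k * (k == l)%:R.
  by rewrite !PTE !coef_lin inner_lincomb -AE (fe k).2 dotcvZl fo.
pose L : {linear X -> Z} := HB.pack PT (GRing.isLinear.Build _ _ _ _ PT PT_lin).
have LE F : L F = \sum_k '[F, g k] *: L (g k).
  (* [F] and its projection onto the span of [g] have the same coordinates along [u], hence the same
     image. To compare them, [coef F] is expanded in the eigenbasis [f]. *)
  transitivity (L (\sum_k '[F, g k] *: g k)); last first.
    by rewrite linear_sum; apply: eq_bigr => k _; rewrite linearZ.
  rewrite /= !PTE; congr lincomb.
  rewrite [LHS](dotcv_basis_expand _ fb).
  apply/colP => n; rewrite mxE inner_suml summxE; apply: eq_bigr => k _.
  rewrite innerZl !mxE; congr (_ * _).
    rewrite inner_sumr dotcvE; apply: eq_bigr => m _.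
    by rewrite innerZr mxE mulrC.
  (* [g k] is [lincomb u (f k)], so its coordinates are the entries of [f k]. *)
  by rewrite -[in LHS](coef_lin (f k)) mxE.
move=> g' tau h.
have ho : orthonormal_family inner h by exact: (@singular_image_orthonormal _ _ _ _ L).
split=> //.
- exact: (@singular_basis _ _ _ _ L).
- by split=> // k l; rewrite iota_isometry ho.
- exact: (@singular_svd _ _ _ _ L).
Qed.
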